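(* For each integer $k\geq -1$, there is a polynomial $h_k(t)\in\mathbb{Q}[t]$ of degree $\lceil k/2\rceil$ such that for all $g\geq \frac{9k+7}{2}$, \[\#\{S\in\mathcal{S}_g\mid e(S)=g-k\}=h_k(g).\] Moreover, $\lceil k/2\rceil!\,h_k(t)$ is a monic polynomial with integer coefficients.
   Context: A numerical semigroup $S$ is a submonoid of $\mathbb{N}_0$ with finite complement; its genus is $|\mathbb{N}_0\setminus S|$. The embedding dimension $e(S)$ is the size of the minimal generating set $(S\setminus\{0\})\setminus((S\setminus\{0\})+(S\setminus\{0\}))$. $\mathcal{S}_g$ is the set of numerical semigroups of genus $g$. *)

(* Defs.v *)
From HB Require Import structures.
From mathcomp Require Import all_boot all_order all_algebra.
From mathcomp Require Import finmap.
Set Implicit Arguments. Unset Strict Implicit. Unset Printing Implicit Defensive.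
Import Order.TTheory GRing.Theory Num.Theory.
Local Open Scope fset_scope.

(* A numerical semigroup S is represented by its (finite) gap set
   G = N_0 \ S; then x \in S <-> x \notin G, and the genus is #|G|. *)
Definition in_sg (G : {fset nat}) (x : nat) : bool := x \notin G.

(* G is the gap set of a numerical semigroup: 0 \in S and S closed under +.
   (Finiteness of the complement is built into the representation.) *)
Definition is_num_semigroup (G : {fset nat}) : Prop :=
  in_sg G 0 /\ forall a b, in_sg G a -> in_sg G b -> in_sg G (a + b).

Definition genus (G : {fset nat}) : nat := #|` G|.

Definition min_gen (G : {fset nat}) (n : nat) : bool :=
  [&& 0 < n, in_sg G n &
      ~~ [exists a : 'I_n, [&& 0 < (a : nat), in_sg G a & in_sg G (n - a)]]].

Definition has_embedding_dim (G : {fset nat}) (e : nat) : Prop :=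
  exists s : seq nat, [/\ uniq s, (forall n, (n \in s) = min_gen G n)
                        & size s = e].

(* Main.v *)
Require Import Defs.
From HB Require Import structures.
From mathcomp Require Import all_boot all_order all_algebra.
From mathcomp Require Import finmap zify.
Set Implicit Arguments. Unset Strict Implicit. Unset Printing Implicit Defensive.
Import Order.TTheory GRing.Theory Num.Theory.

(** Put [K = k + 1] and let [m] be the multiplicity of [S]. The embedding
    dimension is at most [m], so at most [K] gaps exceed [m]; as [g] is large
    compared with [K], so is [m], and a pairing argument shows that no gap
    exceeds [3m]. Hence the gaps are [1, ..., m - 1], [m + B] and [2m + C] with
    [B, C] subsets of [[1, m)]. Let [E] be the set of those [l] in [B] that are
    not a sum of two positive integers outside [B]. Then [S] is a semigroup iff
    [C] is contained in [E], and counting gaps and minimal generators gives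
    [K + |E| = 2 (|B| + |C|)] and [g + 1 = m + |B| + |C|].

    Half of the interval [[0, l]] lies in [B] if [l] is in [E], so [E] lies in
    [[0, 2K]] and depends only on the trace of [B] there. Fixing the traces of
    [B] and [C] on [[0, 2K]] fixes [m] and leaves a free choice of a subset of
    prescribed size of [[2K + 1, m)]. The count is therefore a finite sum of
    binomial coefficients polynomial in [g]. The largest number of free
    elements, [K./2], is attained exactly once: with trace of [B] equal to the
    empty set for [K] even and to [{1}] for [K] odd, and [C] empty. *)

(** * Counting on initial segments of the naturals *)

Definition cnt (P : pred nat) (n : nat) : nat := count P (iota 0 n).

Lemma cntD P n n' : cnt P (n + n') = cnt P n + cnt (fun i => P (n + i)) n'.
Proof. by rewrite /cnt iotaD add0n count_cat -[n in iota n n']addn0 iotaDl count_map. Qed.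

Lemma cntS P n : cnt P n.+1 = cnt P n + P n.
Proof. by rewrite -addn1 cntD /cnt /= addn0 addn0. Qed.

Lemma cnt_le P n : cnt P n <= n.
Proof. by rewrite -[leqRHS](size_iota 0) count_size. Qed.

Lemma eq_cnt (P Q : pred nat) n : (forall i, i < n -> P i = Q i) -> cnt P n = cnt Q n.
Proof. by move=> PQ; apply: eq_in_count => i; rewrite mem_iota => /andP[_]; apply: PQ. Qed.

Lemma sub_cnt (P Q : pred nat) n : (forall i, i < n -> P i -> Q i) -> cnt P n <= cnt Q n.
Proof.
move=> PQ; rewrite -(@eq_cnt (predI P Q) P); first by apply: sub_count => i /andP[].
by move=> i /PQ /=; case: (P i) => // ->.
Qed.

Lemma leq_cnt P n n' : n <= n' -> cnt P n <= cnt P n'.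
Proof. by move=> /subnKC <-; rewrite cntD leq_addr. Qed.

Lemma cntC P n : cnt (predC P) n = n - cnt P n.
Proof. by have := count_predC P (iota 0 n); rewrite size_iota /cnt; lia. Qed.

Lemma cntT (P : pred nat) n : (forall i, i < n -> P i) -> cnt P n = n.
Proof.
move=> HP; rewrite -[RHS](size_iota 0 n); apply/eqP; rewrite -all_count.
by apply/allP => i; rewrite mem_iota => /andP[_]; apply: HP.
Qed.

Lemma cnt0 (P : pred nat) n : (forall i, i < n -> ~~ P i) -> cnt P n = 0.
Proof. by move=> HP; have := cntT HP; rewrite cntC; have := cnt_le P n; lia. Qed.

Lemma cnt_rev (P : pred nat) n : cnt (fun i => P (n - i.+1)) n = cnt P n.
Proof.
elim: n P => // n IH P; rewrite cntS -[in RHS]add1n cntD -(IH (fun i => P (1 + i))).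
rewrite subnn addnC /cnt /= addn0; congr (_ + _); apply: eq_cnt => i i_lt_n.
by rewrite add1n subSn.
Qed.

(** Reflecting [[0, n)] preserves counts, and [P] together with its reflection covers the whole
    segment. *)
Lemma leq_double_cnt (P : pred nat) n :
  (forall i, i < n -> P i || P (n - i.+1)) -> n <= (cnt P n).*2.
Proof.
move=> HP; rewrite -addnn -{2}cnt_rev /cnt -count_predUI.
by rewrite -[leqLHS](cntT HP) leq_addr.
Qed.

Lemma card_fset_cnt (G : {fset nat}) M :
  (forall x, x \in G -> x < M) -> #|` G| = cnt (fun x => x \in G) M.
Proof.
move=> GM; rewrite /cnt -size_filter; apply: perm_size; apply: uniq_perm.
- exact: fset_uniq.
- by rewrite filter_uniq ?iota_uniq.
- by move=> x; rewrite mem_filter mem_iota /= add0n; case xG : (x \in G); rewrite //= GM.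
Qed.

Lemma cnt_leq_card_fset (G : {fset nat}) M : cnt (fun x => x \in G) M <= #|` G|.
Proof.
rewrite /cnt -size_filter; apply: uniq_leq_size; first by rewrite filter_uniq ?iota_uniq.
by move=> x; rewrite mem_filter => /andP[].
Qed.

(** * Minimal generators and indecomposable elements *)

Lemma min_genP (G : {fset nat}) n : reflect
  [/\ 0 < n, n \notin G & forall a, 0 < a -> a < n -> (a \in G) || (n - a \in G)]
  (min_gen G n).
Proof.
rewrite /min_gen /in_sg; apply: (iffP and3P) => -[n0 nH]; last first.
  move=> H1; split=> //; apply/negP => /existsP[a /and3P[a0 aH naH]].
  by have := H1 a a0 (ltn_ord a); rewrite (negbTE aH) (negbTE naH).
move=> /existsPn H1; split=> // a a0 an; have := H1 (Ordinal an).
by rewrite /= a0 /= -negb_or negbK.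
Qed.

(* For [~~ B 0] the pair [(0, l)] in this condition says that [l] itself is in [B]. *)
Definition indec (B : pred nat) (l : nat) : bool :=
  all (fun i => B i || B (l - i)) (iota 0 l.+1).

Lemma indecP (B : pred nat) l : reflect (forall i, i <= l -> B i || B (l - i)) (indec B l).
Proof.
apply: (iffP allP) => H i; first by move=> il; apply: H; rewrite mem_iota.
by rewrite mem_iota => /andP[_]; apply: H.
Qed.

Lemma indec_mem (B : pred nat) l : ~~ B 0 -> indec B l -> B l.
Proof. by move=> B0 /indecP/(_ 0 isT); rewrite (negbTE B0) subn0. Qed.

Lemma indec_lt B l : indec B l -> l < (cnt B l.+1).*2.
Proof. by move=> /indecP H; apply: leq_double_cnt => i il; rewrite subSS H. Qed.

(** * Semigroups with all gaps below [3m] *)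

(** In Kunz coordinates, when [C] lies inside [B]: a residue [l > 0] has coordinate 1 outside [B], 2
    in [B] but not in [C], and 3 in [C]. *)
Definition gap_set (m : nat) (B C : pred nat) : {fset nat} :=
  [fset x in [seq y <- iota 0 (3 * m) |
     [|| 0 < y < m, (m <= y < 2 * m) && B (y - m) | (2 * m <= y) && C (y - 2 * m)]]]%fset.

Lemma mem_gap_set m B C x : (x \in gap_set m B C) =
  (x < 3 * m) && [|| 0 < x < m, (m <= x < 2 * m) && B (x - m)
                   | (2 * m <= x) && C (x - 2 * m)].
Proof. by rewrite inE /= mem_filter mem_iota /= add0n andbC. Qed.

Section GapSet.
Variables (m : nat) (B C : pred nat).
Local Notation G := (gap_set m B C).

Lemma gap_set0 x : x < m -> (x \in G) = (0 < x).
Proof. rewrite mem_gap_set; lia. Qed.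

Lemma gap_set1 l : l < m -> (m + l \in G) = B l.
Proof. by move=> lm; rewrite mem_gap_set addKn; case: (B l); lia. Qed.

Lemma gap_set2 l : l < m -> (2 * m + l \in G) = C l.
Proof. by move=> lm; rewrite mem_gap_set addKn; case: (C l); lia. Qed.

Hypothesis m_gt0 : 0 < m.

Lemma gap_set_genus : genus G + 1 = m + cnt B m + cnt C m.
Proof.
rewrite /genus (@card_fset_cnt _ (m + m + m)); last first.
  by move=> x; rewrite mem_gap_set => /andP[]; lia.
rewrite !cntD (eq_cnt gap_set1).
have -> : cnt (fun i => m + m + i \in G) m = cnt C m.
  by apply: eq_cnt => i im; rewrite addnn -mul2n gap_set2.
have -> : cnt (mem G) m = m.-1.
  rewrite -{2}(prednK m_gt0) -add1n cntD /cnt /= gap_set0 // addn0 add0n.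
  by apply: cntT => i im; rewrite gap_set0; lia.
lia.
Qed.

Hypotheses (B0 : ~~ B 0) (C_indec : forall l, C l -> indec B l).

Lemma gap_set_semigroup : is_num_semigroup G.
Proof.
split; rewrite /in_sg; first by rewrite gap_set0.
move=> a b aG bG; apply/negP => abG.
have [am|am] := ltnP a m; first by move: aG abG bG; rewrite gap_set0 // -eqn0Ngt => /eqP->->.
have [bm|bm] := ltnP b m.
  by move: bG abG aG; rewrite gap_set0 // -eqn0Ngt => /eqP->; rewrite addn0 => ->.
have ab3 : a + b < 3 * m by move: abG; rewrite mem_gap_set => /andP[].
(* Both summands are at least [m], so the gap [a + b] can only come from [C]. *)
have : C (a - m + (b - m)).
  by rewrite -gap_set2; [suff -> : 2 * m + (a - m + (b - m)) = a + b by [] |]; lia.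
move/C_indec/indecP/(_ (a - m)); rewrite leq_addr addKn => /(_ isT).
by rewrite -!gap_set1 ?subnKC ?(negbTE aG) ?(negbTE bG) //; lia.
Qed.

Hypothesis B_small : (cnt B m).*2 < m.

(* If [2m + l] is a gap then [3m + l] is nevertheless decomposable: pairing
   [i] with [m + l - i], half of the elements of [[l+1, m)] would otherwise
   lie in [B], as well as half of those of [[0, l]]. *)
Lemma decomposition_above l : l < m -> indec B l ->
  exists i, [/\ l < i, i < m, ~~ B i & ~~ B (m + l - i)].
Proof.
move=> lm /[dup] Bl /indec_lt lB.
case: (boolP (has (fun i => ~~ B (l.+1 + i) && ~~ B (l.+1 + (m - l.+1 - i.+1)))
              (iota 0 (m - l.+1)))) => [/hasP[i] | /hasPn H].
  rewrite mem_iota => /andP[_ im] /andP[Bi Bi']; exists (l.+1 + i); split=> //; try lia.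
  by have -> : m + l - (l.+1 + i) = l.+1 + (m - l.+1 - i.+1) by lia.
have /leq_double_cnt : forall i, i < m - l.+1 ->
    B (l.+1 + i) || B (l.+1 + (m - l.+1 - i.+1)).
  by move=> i im; rewrite -[_ || _]negbK negb_or H // mem_iota.
have := cntD B l.+1 (m - l.+1); rewrite subnKC //; lia.
Qed.

Lemma min_gen0 n : n < m -> ~~ min_gen G n.
Proof. by move=> nm; apply/negP => /min_genP[n0]; rewrite gap_set0 ?n0. Qed.

Lemma min_gen1 l : l < m -> min_gen G (m + l) = ~~ B l.
Proof.
move=> lm; apply/min_genP/idP => [[_]|Bl]; first by rewrite gap_set1.
split; [lia | by rewrite gap_set1 |] => a a0 aml.
have [am|am] := ltnP a m; first by rewrite gap_set0 ?a0.
by rewrite orbC gap_set0; lia.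
Qed.

(** Positive numbers below [m] are gaps, so the only splittings that matter are into [m + i] and
    [m + (l - i)]. *)
Lemma min_gen2 l : l < m -> min_gen G (2 * m + l) = indec B l && ~~ C l.
Proof.
move=> lm; apply/min_genP/andP => [[_]|[/indecP Bl Cl]].
  rewrite gap_set2 // => Cl H; split=> //; apply/indecP => i il.
  have := H (m + i); have -> : 2 * m + l - (m + i) = m + (l - i) by lia.
  by rewrite !gap_set1; [apply |..]; lia.
split; [lia | by rewrite gap_set2 |] => a a0 aml.
have [am|am] := ltnP a m; first by rewrite gap_set0 ?a0.
have [bm|bm] := ltnP (2 * m + l - a) m; first by rewrite orbC gap_set0; lia.
have -> : a = m + (a - m) by lia.
have -> : 2 * m + l - (m + (a - m)) = m + (l - (a - m)) by lia.
by rewrite !gap_set1 ?Bl; lia.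
Qed.

(** Since [m] is not a gap, a minimal generator [n > m] makes [n - m] a gap; so [n = 3m + l] with
    [l] in [C], and [decomposition_above] splits [n]. *)
Lemma min_gen3 n : 3 * m <= n -> ~~ min_gen G n.
Proof.
move=> n3; apply/negP => /min_genP[n0 nG H].
have mG : m \in G = false by have := gap_set1 m_gt0; rewrite addn0 (negbTE B0).
have := H m m_gt0; rewrite mG /= => /(_ ltac:(lia)) nmG.
have n4 : n - m < 3 * m by move: nmG; rewrite mem_gap_set => /andP[].
have lm : n - 3 * m < m by lia.
have : C (n - 3 * m).
  by rewrite -gap_set2 //; have -> : 2 * m + (n - 3 * m) = n - m by lia.
move/C_indec/(decomposition_above lm) => [i [li im Bi Bi']].
have := H (m + i); have -> : n - (m + i) = m + (m + (n - 3 * m) - i) by lia.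
rewrite !gap_set1 ?(negbTE Bi) ?(negbTE Bi') //; lia.
Qed.

(** There are [m - |B|] minimal generators in [[m, 2m)], [|E| - |C|] in [[2m, 3m)] with
    [E = indec B], and none elsewhere. *)
Lemma gap_set_embedding_dim e : has_embedding_dim G e <->
  e + cnt B m + cnt C m = m + cnt (indec B) m.
Proof.
pose s := [seq n <- iota 0 (m + m + m) | min_gen G n].
have s_uniq : uniq s by rewrite filter_uniq ?iota_uniq.
have s_mem n : (n \in s) = min_gen G n.
  rewrite mem_filter mem_iota /= add0n; case: ltnP; rewrite ?andbT ?andbF // => n3.
  by rewrite (negbTE (min_gen3 _)) //; lia.
have s_size : size s + cnt B m + cnt C m = m + cnt (indec B) m.
  rewrite size_filter -/(cnt (min_gen G) (m + m + m)) !cntD (cnt0 min_gen0) (eq_cnt min_gen1).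
  rewrite -/(predC B) [cnt (fun i => ~~ B i) m]cntC.
  have -> : cnt (fun i => min_gen G (m + m + i)) m =
            cnt (fun l => indec B l && ~~ C l) m.
    by apply: eq_cnt => i im; rewrite addnn -mul2n min_gen2.
  have : cnt (fun l => indec B l && ~~ C l) m + cnt C m = cnt (indec B) m.
    rewrite /cnt -count_predUI addnC.
    rewrite (@eq_count _ (predI _ _) pred0) ?count_pred0; last first.
      by move=> l /=; case: (C l); rewrite ?andbF.
    apply: eq_count => l /=; have := @C_indec l.
    by case: (C l); case: (indec B l) => //= /(_ isT).
  have := cnt_le B m; lia.
split=> [[s' [s'u s's <-]]|es].
  rewrite -s_size; congr (_ + _ + _); apply: perm_size; apply: uniq_perm => // n.
  by rewrite s's s_mem.
by exists s; split=> //; lia.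
Qed.

End GapSet.

Lemma eq_gap_set m (B B' C C' : pred nat) :
  (forall l, l < m -> B l = B' l) -> (forall l, l < m -> C l = C' l) ->
  gap_set m B C = gap_set m B' C'.
Proof.
move=> eqB eqC; apply/fsetP => x; rewrite !mem_gap_set.
case: (ltnP x (3 * m)) => //= x3; congr [|| _, _ | _].
  by case: (boolP (m <= x < 2 * m)) => //= x1; apply: eqB; lia.
by case: (leqP (2 * m) x) => //= x2; apply: eqC; lia.
Qed.

(** * Bounds from the multiplicity *)

Section Multiplicity.
Variables (G : {fset nat}) (m : nat).
Hypotheses (G_semigroup : is_num_semigroup G) (m_gt0 : 0 < m) (mG : m \notin G).
Hypothesis below_m : forall x, 0 < x -> x < m -> x \in G.

Lemma gap_split a b : a + b \in G -> (a \in G) || (b \in G).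
Proof.
case: G_semigroup => _ GD; apply: contraLR; rewrite negb_or => /andP[].
exact: GD.
Qed.

Lemma gap_sub_mult x : x \in G -> m <= x -> x - m \in G.
Proof. by move=> xG mx; have := @gap_split m (x - m); rewrite subnKC // (negbTE mG); apply. Qed.

Lemma gap_sub_mults q x : x \in G -> q * m <= x -> x - q * m \in G.
Proof.
elim: q => [|q IH] xG qx; first by rewrite subn0.
have -> : x - q.+1 * m = x - q * m - m by lia.
by apply: gap_sub_mult; [apply: IH => //|]; lia.
Qed.

(** If [x < y] were congruent, [y - x] would be a multiple of [m], hence no gap, and
    [y = x + (y - x)] would decompose. *)
Lemma min_gen_mod_inj x y : min_gen G x -> min_gen G y -> x = y %[mod m] -> x <= y -> x = y.
Proof.
move=> /min_genP[x0 xG _] /min_genP[_ yG Hy] xy; rewrite leq_eqVlt => /orP[/eqP//|lt_xy].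
have := Hy x x0 lt_xy; rewrite (negbTE xG) /= => yxG.
have /dvdnP[q yxE] : m %| y - x by rewrite -eqn_mod_dvd 1?ltnW //; apply/eqP.
case: G_semigroup => /negP + _; have := @gap_sub_mults q _ yxG.
by rewrite yxE subnn leqnn => ->.
Qed.

Lemma embedding_dim_le_mult e : has_embedding_dim G e -> e <= m.
Proof.
case=> s [s_uniq s_mem <-]; rewrite -(size_map (modn^~ m)) -[leqRHS](size_iota 0).
apply: uniq_leq_size; last first.
  by move=> _ /mapP[x _ ->]; rewrite mem_iota ltn_pmod.
rewrite map_inj_in_uniq // => x y; rewrite !s_mem => xs ys xy.
by case: (leqP x y) => [|/ltnW] le_xy; [|symmetry]; apply: min_gen_mod_inj.
Qed.

Lemma cnt_gaps_above_mult n : m + cnt (fun i => m + i \in G) n <= (genus G).+1.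
Proof.
have := cnt_leq_card_fset G (m + n); rewrite cntD.
have := cntD (fun x => x \in G) 1 m.-1; rewrite add1n prednK //.
rewrite [cnt (fun i => 1 + i \in G) _]cntT ?/genus; first lia.
by move=> i im; apply: below_m; lia.
Qed.

(* Pairing [m + i] with [2m + l - i] for [0 <= i <= m + l], a gap [3m + l]
   forces more than [m / 2] gaps above [m]. *)
Lemma gaps_lt_3mult x : 2 * (genus G).+1 < 3 * m -> x \in G -> x < 3 * m.
Proof.
move=> gm xG; rewrite ltnNge; apply/negP => x3.
(* Removing copies of [m] brings the gap down into [[3m, 4m)]. *)
have [l [lm lG]] : exists l, l < m /\ 3 * m + l \in G.
  exists (x %% m); split; first by rewrite ltn_pmod.
  have x3m : 3 <= x %/ m by rewrite leq_divRL.
  have xE := divn_eq x m.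
  have -> : 3 * m + x %% m = x - (x %/ m - 3) * m by rewrite mulnBl; nia.
  by apply: gap_sub_mults => //; rewrite mulnBl; nia.
have /leq_double_cnt : forall i, i < m + l.+1 ->
    (m + i \in G) || (m + (m + l.+1 - i.+1) \in G).
  move=> i il; apply: gap_split.
  by have -> : m + i + (m + (m + l.+1 - i.+1)) = 3 * m + l by lia.
have := cnt_gaps_above_mult (m + l.+1); lia.
Qed.

End Multiplicity.

Lemma multiplicity_exists (G : {fset nat}) :
  exists m, [/\ 0 < m, m \notin G & forall x, 0 < x -> x < m -> x \in G].
Proof.
have exP : exists n, (0 < n) && (n \notin G).
  exists (\max_(x <- G) x).+1; apply/negP => xG.
  by have := @leq_bigmax_seq _ (enum_fset G) xpredT id _ xG isT; rewrite ltnn.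
have [m /andP[m_gt0 mG] m_min] := ex_minnP exP; exists m; split=> // x x0 xm.
by apply: contraTT xm => xG; rewrite -leqNgt m_min ?x0.
Qed.

(** * Semigroups as triples [(m, B, C)] *)

(** The equation in [K] is [e + K = g + 1] with [e] eliminated. Confining [B], and hence [C], to
    [[0, m)] fixes both where [gap_set] does not read them. *)
Definition shape_for (K g m : nat) (B C : pred nat) : Prop :=
  [/\ [/\ 0 < m, ~~ B 0, forall l, B l -> l < m & forall l, C l -> indec B l],
      K + cnt (indec B) m = 2 * (cnt B m + cnt C m) & g + 1 = m + cnt B m + cnt C m].

Lemma shape_for_bound K g m B C : shape_for K g m B C -> cnt B m + cnt C m <= K.
Proof.
case=> [[_ B0 _ _] KE _]; suff : cnt (indec B) m <= cnt B m by lia.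
by apply: sub_cnt => l _; apply: indec_mem.
Qed.

Lemma shape_forP K g e (G : {fset nat}) : 9 * K <= 2 * g + 2 -> e + K = g + 1 ->
  [/\ is_num_semigroup G, genus G = g & has_embedding_dim G e] <->
  exists m B C, shape_for K g m B C /\ G = gap_set m B C.
Proof.
move=> gK eK; split; last first.
  move=> [m [B [C [S ->]]]]; have := shape_for_bound S.
  case: S => [[m_gt0 B0 Bm CB] KE gE] KB; split.
  - exact: gap_set_semigroup.
  - by have := gap_set_genus B C m_gt0; lia.
  - by apply/gap_set_embedding_dim => //; lia.
case=> G_sg G_g G_e; have [m [m_gt0 mG Gm]] := multiplicity_exists G.
have em := embedding_dim_le_mult G_sg m_gt0 mG G_e.
(* From [m >= e = g + 1 - K] and [9K <= 2g + 2] follows [2 (g + 1) < 3m]. *)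
have G3 : forall x, x \in G -> x < 3 * m.
  by move=> x; apply: gaps_lt_3mult => //; rewrite G_g; lia.
have rK := cnt_gaps_above_mult m_gt0 mG Gm m.
pose B l := (l < m) && (m + l \in G); pose C l := (l < m) && (2 * m + l \in G).
have CB l : C l -> indec B l.
  move=> /andP[lm lG]; apply/indecP => i il; rewrite /B.
  have -> : i < m by lia.
  have -> /= : l - i < m by lia.
  by apply: (gap_split G_sg); have -> : m + i + (m + (l - i)) = 2 * m + l by lia.
have B0 : ~~ B 0 by rewrite /B addn0 (negbTE mG) andbF.
have GE : G = gap_set m B C.
  apply/fsetP => x; rewrite mem_gap_set.
  case: (ltnP x (3 * m)) => [x3|]; last by move=> x3; apply/negP => /G3; lia.
  have [->|x0] := posnP x; first by case: G_sg => /negbTE ->; lia.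
  have [xm|mx] := ltnP x m; first by rewrite Gm.
  rewrite /B /C subnKC //; have [x2|x2] := ltnP x (2 * m).
    by case: (x \in G); lia.
  by rewrite subnKC //; case: (x \in G); lia.
have cB : cnt B m <= K.
  rewrite (@eq_cnt B (fun i => m + i \in G)) ?/B; last by move=> i ->.
  by rewrite G_g in rK; lia.
have := gap_set_genus B C m_gt0; rewrite -GE G_g => gE.
have := G_e; rewrite {1}GE => /gap_set_embedding_dim eE.
exists m, B, C; split=> //; split=> //; first by split=> // l /andP[].
by have := eE m_gt0 B0 CB ltac:(lia); lia.
Qed.

Lemma gap_set_inj m m' (B C B' C' : pred nat) : 0 < m -> 0 < m' -> ~~ B 0 -> ~~ B' 0 ->
  gap_set m B C = gap_set m' B' C' ->
  [/\ m = m', forall l, l < m -> B l = B' l & forall l, l < m -> C l = C' l].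
Proof.
move=> m0 m0' b0 b0' eqG.
have mem x := congr1 (fun G : {fset nat} => x \in G) eqG.
(* As [B 0] fails, [m] is the least positive non-gap. *)
have mm' : m = m'.
  have := mem m; have := mem m'.
  have := @gap_set1 m B C 0 m0; have := @gap_set1 m' B' C' 0 m0'.
  rewrite !addn0 (negbTE b0) (negbTE b0') => -> ->.
  case: (ltngtP m m') => // lt_mm'; [move=> _ | move=> + _];
    by rewrite gap_set0 //= ?m0 ?m0'.
rewrite -{}mm' in mem *; split=> // l lm.
  by have := mem (m + l); rewrite !gap_set1.
by have := mem (2 * m + l); rewrite !gap_set2.
Qed.

(** * Finite sets of ordinals as predicates *)

Definition memn (n : nat) (A : {set 'I_n}) (x : nat) : bool :=
  [exists i in A, val i == x].

Lemma memnE n (A : {set 'I_n}) (i : 'I_n) : memn A i = (i \in A).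
Proof.
apply/exists_inP/idP => [[j jA /eqP/val_inj <-] //|iA].
by exists i.
Qed.

Lemma memn_lt n (A : {set 'I_n}) x : memn A x -> x < n.
Proof. by move=> /exists_inP[j _ /eqP <-]; apply: ltn_ord. Qed.

Lemma memn_set n (P : pred nat) x : x < n -> memn [set i : 'I_n | P i] x = P x.
Proof. by move=> xn; have := memnE [set i : 'I_n | P i] (Ordinal xn); rewrite inE. Qed.

Lemma cnt_card n (P : pred nat) : cnt P n = #|[set i : 'I_n | P i]|.
Proof.
by rewrite cardsE cardE /enum_mem size_filter /cnt -val_enum_ord count_map enumT.
Qed.

Lemma cnt_widen (P : pred nat) n n' :
  n <= n' -> (forall i, n <= i -> ~~ P i) -> cnt P n' = cnt P n.
Proof.
move=> /subnKC <- Pn; rewrite cntD [X in _ + X]cnt0 ?addn0 // => i _.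
exact/Pn/leq_addr.
Qed.

Lemma cnt_memn n (A : {set 'I_n}) q :
  (forall x, memn A x -> x < q) -> cnt (memn A) q = #|A|.
Proof.
move=> Aq; have -> : #|A| = cnt (memn A) n.
  by rewrite cnt_card; apply: eq_card => i; rewrite inE memnE.
case: (leqP n q) => [nq|/ltnW qn]; [|symmetry]; apply: cnt_widen => // i.
  by apply: contraTN => /memn_lt; rewrite ltnNge.
by apply: contraTN => /Aq; rewrite ltnNge.
Qed.

Lemma eq_indec (B B' : pred nat) l :
  (forall i, i <= l -> B i = B' i) -> indec B l = indec B' l.
Proof.
move=> eqB; apply: eq_in_all => i; rewrite mem_iota => /andP[_ il].
by rewrite !eqB //; lia.
Qed.

(** * Coding by traces and free elements *)

Section Count.
Variable K : nat.
Local Notation N := (K.*2.+1).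

Definition indecs (B : {set 'I_N}) : {set 'I_N} := [set l : 'I_N | indec (memn B) l].

(* [P.1] and [P.2] are the traces on [[0, N)] of the sets [B] and [C]
   of [shape_for]; [excess P = #|B| + #|C|]. *)
Definition excess (P : {set 'I_N} * {set 'I_N}) : nat := (K + #|indecs P.1|)./2.

(** The number of elements left for [B] to have in [[N, m)]. *)
Definition nfree (P : {set 'I_N} * {set 'I_N}) : nat := excess P - (#|P.1| + #|P.2|).

(** The last two conditions make the halving in [excess] and the subtraction in [nfree] exact. *)
Definition good_pair (P : {set 'I_N} * {set 'I_N}) : bool :=
  [&& ord0 \notin P.1, P.2 \subset indecs P.1, ~~ odd (K + #|indecs P.1|)
    & #|P.1| + #|P.2| <= excess P].

Lemma indecs_sub (B : {set 'I_N}) : ord0 \notin B -> indecs B \subset B.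
Proof.
rewrite -(memnE B ord0) => B0; apply/subsetP => l.
by rewrite inE -memnE; apply: indec_mem.
Qed.

(** From [|indecs P.1| <= |P.1| <= excess P] follows [2 * excess P <= K + excess P]. *)
Lemma excess_leq P : good_pair P -> excess P <= K.
Proof.
case/and4P => /indecs_sub/subset_leq_card P0 _ _; rewrite /excess; lia.
Qed.

Variable g : nat.

(** The last component is [B] on [[N, m)] shifted down by [N]; since [m = g + 1 - excess], its bound
    is [g - excess - 2K]. The ambient ['I_g.+1] serves all traces at once. *)
Definition codes : {set ({set 'I_N} * {set 'I_N}) * {set 'I_g.+1}} :=
  [set c | good_pair c.1 && (c.2 \in [set A : {set 'I_g.+1} |
    A \subset [set i : 'I_g.+1 | i < g - excess c.1 - K.*2] & #|A| == nfree c.1])].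

Lemma card_codes :
  #|codes| = \sum_(P | good_pair P) 'C(g - excess P - K.*2, nfree P).
Proof.
rewrite -sum1_card.
under eq_bigl do rewrite inE.
rewrite -(pair_big_dep good_pair (fun P A => A \in [set A : {set 'I_g.+1} |
    A \subset [set i : 'I_g.+1 | i < g - excess P - K.*2] & #|A| == nfree P])
    (fun _ _ => 1)) /=.
apply: eq_bigr => P _; rewrite sum1_card cards_draws; congr 'C(_, _).
have := cnt_card g.+1 (fun i => i < g - excess P - K.*2) => <-.
have -> : g.+1 = (g - excess P - K.*2) + (g.+1 - (g - excess P - K.*2)) by lia.
by rewrite cntD cntT ?cnt0 ?addn0 // => i; lia.
Qed.

Definition glue (B0 : {set 'I_N}) (B1 : {set 'I_g.+1}) (x : nat) : bool :=
  memn B0 x || (N <= x) && memn B1 (x - N).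

Definition decode (c : ({set 'I_N} * {set 'I_N}) * {set 'I_g.+1}) : {fset nat} :=
  gap_set (g.+1 - excess c.1) (glue c.1.1 c.2) (memn c.1.2).

Lemma glue_lo B0 B1 x : x < N -> glue B0 B1 x = memn B0 x.
Proof. by rewrite /glue ltnNge => /negbTE->; rewrite orbF. Qed.

Lemma glue_hi B0 B1 x : glue B0 B1 (N + x) = memn B1 x.
Proof.
rewrite /glue leq_addr addKn; case: (boolP (memn B0 _)) => // /memn_lt; lia.
Qed.

Section Glue.
Variables (B0 C0 : {set 'I_N}) (B1 : {set 'I_g.+1}) (m : nat).
Hypotheses (Nm : N <= m) (B1m : forall x, memn B1 x -> x < m - N).

Lemma cnt_glue : cnt (glue B0 B1) m = #|B0| + #|B1|.
Proof.
rewrite -(subnKC Nm) cntD (eq_cnt (@glue_lo B0 B1)) cnt_memn; last exact: memn_lt.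
by rewrite (eq_cnt (fun i _ => @glue_hi B0 B1 i)) cnt_memn.
Qed.

Lemma cnt_memn_ge : cnt (memn C0) m = #|C0|.
Proof. by apply: cnt_memn => x /memn_lt xN; lia. Qed.

(** An indecomposable [l >= N] would force more than [K] elements below [m]; for [l < N] only [B0]
    is read. *)
Lemma cnt_indec_glue : #|B0| + #|B1| <= K -> cnt (indec (glue B0 B1)) m = #|indecs B0|.
Proof.
move=> BK; rewrite -(subnKC Nm) cntD [X in _ + X]cnt0 => [|i im].
  rewrite addn0 cnt_card; apply: eq_card => l; rewrite !inE.
  by apply: eq_indec => i il; rewrite glue_lo //; have := ltn_ord l; lia.
apply/negP => /indec_lt; have := @leq_cnt (glue B0 B1) (N + i).+1 m ltac:(lia).
rewrite cnt_glue; lia.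
Qed.
End Glue.

Hypothesis gK : 9 * K <= 2 * g + 2.

Lemma codesP c : c \in codes ->
  [/\ good_pair c.1, #|c.2| = nfree c.1, excess c.1 <= K,
      N <= g.+1 - excess c.1 & forall x, memn c.2 x -> x < g.+1 - excess c.1 - N].
Proof.
rewrite !inE => /andP[cg /andP[/subsetP cs /eqP cf]]; have ck := excess_leq cg.
split=> //; first lia.
by move=> x /exists_inP[i /cs + /eqP <-]; rewrite inE /=; lia.
Qed.

Lemma decode_shape c : c \in codes ->
  shape_for K g (g.+1 - excess c.1) (glue c.1.1 c.2) (memn c.1.2).
Proof.
case/codesP => /[dup] cg /and4P[c0 cC codd cle] cf cK Nm cm.
have cB := cnt_glue c.1.1 Nm cm.
have cE : #|c.1.1| + #|c.2| + #|c.1.2| = excess c.1 by rewrite cf /nfree addnAC subnKC.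
have cEK : K + #|indecs c.1.1| = 2 * excess c.1.
  by rewrite mul2n /excess even_halfK.
split; last 2 first.
- by rewrite cnt_indec_glue // ?cB ?cnt_memn_ge ?cE //; lia.
- by rewrite -addnA [cnt _ _ + _]addnC cB cnt_memn_ge //; lia.
split; first lia.
- by rewrite glue_lo // (memnE _ ord0).
- move=> l /orP[/memn_lt|/andP[lN /cm]]; lia.
- move=> l lC; have lN := memn_lt lC; rewrite (@eq_indec _ (memn c.1.1)); last first.
    by move=> i il; rewrite glue_lo //; lia.
  have : Ordinal lN \in c.1.2 by rewrite -memnE.
  by move/(subsetP cC); rewrite inE.
Qed.

Lemma decode_inj : {in codes &, injective decode}.
Proof.
move=> c c' cc cc'; have [_ _ ck Nm cm] := codesP cc; have [_ _ ck' Nm' cm'] := codesP cc'.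
have [[m0 b0 _ _] _ _] := decode_shape cc; have [[m0' b0' _ _] _ _] := decode_shape cc'.
move=> /(gap_set_inj m0 m0' b0 b0')[mm' eqB eqC].
case: c c' {cc cc'} ck ck' Nm Nm' cm cm' m0 m0' b0 b0' mm' eqB eqC
  => [[B0 C0] B1] [[B0' C0'] B1'] /= ck ck' Nm Nm' cm cm' m0 m0' b0 b0' mm' eqB eqC.
congr (_, _, _); apply/setP => i; rewrite -!memnE.
- by have := eqB i; rewrite !glue_lo //; apply; have := ltn_ord i; lia.
- by apply: eqC; have := ltn_ord i; lia.
- have [im|im] := ltnP i (g.+1 - excess (B0, C0) - N); first by have := eqB (N + i); rewrite !glue_hi -ltn_subRL; apply.
  by apply/idP/idP => [/cm|/cm']; rewrite -?mm' ltnNge im.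
Qed.

Lemma decode_surj m B C : shape_for K g m B C ->
  exists2 c, c \in codes & gap_set m B C = decode c.
Proof.
move=> S; have BK := shape_for_bound S; case: S => [[m0 b0 Bm CB] KE gE].
have Nm : N <= m by lia.
have indK l : indec B l -> l < N.
  move=> /[dup] /(indec_mem b0)/Bm lm /indec_lt; have := @leq_cnt B l.+1 m lm; lia.
(* By [indK] all of [C] lies below [N], so its trace loses nothing. *)
pose B0 := [set i : 'I_N | B i]; pose C0 := [set i : 'I_N | C i].
pose B1 := [set i : 'I_g.+1 | B (N + i)].
have B1m x : memn B1 x -> x < m - N.
  by move=> /exists_inP[i + /eqP <-]; rewrite inE => /Bm /=; lia.
have BE l : B l = glue B0 B1 l.
  have [lN|lN] := ltnP l N; first by rewrite glue_lo // memn_set.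
  rewrite -(subnKC lN) glue_hi; have [lg|lg] := ltnP (l - N) g.+1.
    by rewrite (memn_set (fun x => B (N + x))).
  apply/idP/idP => [/Bm|/memn_lt]; lia.
have CE l : C l = memn C0 l.
  have [lN|lN] := ltnP l N; first by rewrite memn_set.
  by apply/idP/idP => [/CB/indK|/memn_lt]; lia.
have cB : cnt B m = #|B0| + #|B1| by rewrite (eq_cnt (fun l _ => BE l)) cnt_glue.
have cC : cnt C m = #|C0| by rewrite (eq_cnt (fun l _ => CE l)) cnt_memn_ge.
have cE : cnt (indec B) m = #|indecs B0|.
  rewrite -(@cnt_indec_glue B0 B1 m) //; last by rewrite -cB (leq_trans _ BK) ?leq_addr.
  by apply: eq_cnt => l _; apply: eq_indec.
have ex : excess (B0, C0) = #|B0| + #|B1| + #|C0| by rewrite /excess /= -cE KE mul2n doubleK cB cC.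
have mE : g.+1 - excess (B0, C0) = m by rewrite ex -cB -cC; lia.
exists (B0, C0, B1); last first.
  by rewrite /decode mE; apply: eq_gap_set => l _; [apply: BE | apply: CE].
rewrite !inE /= /nfree; apply/andP; split; last first.
  have <- : #|B1| = excess (B0, C0) - (#|B0| + #|C0|) by rewrite ex addnAC addKn.
  rewrite eqxx andbT.
  by apply/subsetP => i; rewrite -memnE inE => /B1m; lia.
apply/and4P; split=> /=.
- by rewrite inE.
- apply/subsetP => l; rewrite !inE => /CB.
  by rewrite (@eq_indec B (memn B0)) // => i il; rewrite memn_set //; have := ltn_ord l; lia.
- by rewrite -cE KE mul2n odd_double.
- by rewrite ex leq_add2r leq_addr.
Qed.

Lemma count_semigroups e : e + K = g + 1 ->
  exists s : seq {fset nat}, [/\ uniq s,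
    (forall G, G \in s <->
       [/\ is_num_semigroup G, genus G = g & has_embedding_dim G e])
    & size s = \sum_(P | good_pair P) 'C(g - excess P - K.*2, nfree P)].
Proof.
move=> eK; exists [seq decode c | c <- enum codes]; split.
- rewrite map_inj_in_uniq ?enum_uniq // => c c'; rewrite !mem_enum.
  exact: decode_inj.
- move=> G; rewrite (shape_forP _ gK eK); split=> [/mapP[c]|].
    rewrite mem_enum => /decode_shape S ->.
    by exists (g.+1 - excess c.1), (glue c.1.1 c.2), (memn c.1.2).
  move=> [m [B [C [/decode_surj[c cc ->] ->]]]].
  by apply: map_f; rewrite mem_enum.
- by rewrite size_map -cardE card_codes.
Qed.

End Count.

(** * The traces with most free elements *)

Section LeadingTerm.
Variable K : nat.
Local Notation N := (K.*2.+1).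

(** For [K] odd, parity requires an odd number of indecomposables, so [P.1] cannot be empty. *)
Definition top_pair : {set 'I_N} * {set 'I_N} :=
  (if odd K then [set inord 1] else set0, set0).

Lemma card_indecs_top : #|indecs top_pair.1| = odd K.
Proof.
rewrite /top_pair /=; case: ifP => Kodd; last first.
  by apply/eqP; rewrite cards_eq0 -subset0 indecs_sub // inE.
(* For [K] odd, [N >= 3], so [inord 1] is not the default value. *)
have K1 : val (inord 1 : 'I_N) = 1 by rewrite /= inordK //; case: K Kodd.
have m1 : memn [set inord 1 : 'I_N] 1 by rewrite -[X in memn _ X]K1 memnE inE.
suff -> : indecs [set inord 1] = [set inord 1 : 'I_N] by rewrite cards1.
apply/eqP; rewrite eqEsubset indecs_sub; last first.
  by rewrite inE; apply/eqP => /(congr1 val); rewrite K1.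
by rewrite sub1set inE K1 /indec /= m1 orbT.
Qed.

Lemma excess_top : excess top_pair = K./2 + odd K.
Proof. by rewrite /excess card_indecs_top; lia. Qed.

Lemma good_top : good_pair top_pair.
Proof.
have Ktop := card_indecs_top; apply/and4P; split; last 2 first.
- by rewrite Ktop oddD oddb addbb.
- by rewrite excess_top /top_pair cards0 addn0; case: ifP; rewrite ?cards1 ?cards0 //; lia.
- rewrite /top_pair /=; case: ifP => [Kodd|_]; last by rewrite inE.
  rewrite inE; apply/eqP => /(congr1 val); rewrite /= inordK //.
  by case: K Kodd.
- exact: sub0set.
Qed.

Lemma nfree_top : nfree top_pair = K./2.
Proof.
rewrite /nfree excess_top /top_pair cards0 addn0.
by case: ifP => Kodd; rewrite ?cards1 ?cards0 /=; lia.
Qed.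

(* [2 nfree P = K + #|indecs P.1| - 2 #|P.1| - 2 #|P.2| <= K - #|P.1| - 2 #|P.2|],
   so a maximal [nfree P] leaves at most one element in [P.1] and none in [P.2]. *)
Lemma nfree_lt_top P : good_pair P -> P != top_pair -> nfree P < K./2.
Proof.
case: P => B C /and4P[/= B0 _ Kodd le_ex].
have /subset_leq_card iB := indecs_sub B0.
have exE : K + #|indecs B| = (excess (B, C)).*2 by rewrite /excess even_halfK.
rewrite /nfree ltnNge; apply: contra => /= le_free.
have {}le_free : #|B| + #|C|.*2 <= odd K.
  by move: exE iB le_ex le_free; move: #|B| #|C| #|indecs B| (excess _) => b c i x; lia.
have /eqP : #|C| = 0 by lia.
rewrite cards_eq0 => /eqP ->; apply/eqP; congr (_, _).
case: ifP => K1; last first.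
  by apply/eqP; rewrite -cards_eq0; rewrite K1 in le_free; lia.
have iB1 : #|indecs B| = 1 by move: Kodd; rewrite oddD K1; case: #|indecs B| iB => [|[|?]] //; lia.
have /cards1P[x Bx] : #|B| == 1 by lia.
have xi : x \in indecs B.
  have /card_gt0P[y yi] : 0 < #|indecs B| by rewrite iB1.
  by have := subsetP (indecs_sub B0) _ yi; rewrite {1}Bx inE => /eqP <-.
have x0 : x != ord0 by apply: contraNneq B0 => <-; rewrite Bx inE.
(* At least half of [[0, x]] lies in the singleton [B], so [x <= 1]. *)
have x1 : val x = 1.
  move: xi x0; rewrite inE -(inj_eq val_inj) /= => /indec_lt.
  have := @leq_cnt (memn B) x.+1 N (ltn_ord x).
  by rewrite (cnt_memn (@memn_lt _ B)) Bx cards1; lia.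
by rewrite Bx; congr [set _]; apply: val_inj; rewrite x1 /= inordK //; case: K K1.
Qed.

End LeadingTerm.

(** * The counting polynomial *)

Local Open Scope ring_scope.

Lemma horner_prod_ffact (R : comNzRingType) (x a n : nat) : (a <= x)%N ->
  (\prod_(i <- iota 0 n) ('X - ((a + i)%N%:R : R)%:P)).[x%:R] = ((x - a) ^_ n)%N%:R.
Proof.
move=> ax; elim: n => [|n IH]; first by rewrite big_nil hornerE.
rewrite -addn1 iotaD big_cat /= hornerM IH big_cons big_nil mulr1 add0n hornerXsubC.
rewrite addn1 ffactnSr natrM.
(* Once [n > x - a] the product is already 0, so truncation in the next factor is harmless. *)
have [nx|nx] := leqP n (x - a); last by rewrite ffact_small ?mul0r.
by congr (_ * _); rewrite -subnDA natrB //; lia.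
Qed.

(** This is [(K./2)!] times the count. With [n = nfree P], the binomial is a falling factorial over
    [n!], and the integer [(K./2)! / n!] is itself a falling factorial. *)
Definition count_poly (K : nat) : {poly int} :=
  \sum_(P | @good_pair K P) (K./2 ^_ (K./2 - nfree P))%:R *:
     \prod_(i <- iota 0 (nfree P)) ('X - ((excess P + K.*2 + i)%N%:R)%:P).

Lemma nfree_leq_half K (P : {set 'I_K.*2.+1} * {set 'I_K.*2.+1}) :
  good_pair P -> (nfree P <= K./2)%N.
Proof.
have [->|neq] := eqVneq P (top_pair K); first by rewrite nfree_top.
by move=> gP; apply/ltnW/nfree_lt_top.
Qed.

Lemma horner_count_poly K g : (9 * K <= 2 * g + 2)%N ->
  (count_poly K).[g%:R] =
  ((K./2)`! * \sum_(P | @good_pair K P) 'C(g - excess P - K.*2, nfree P))%N%:R.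
Proof.
move=> gK; rewrite horner_sum big_distrr /= natr_sum; apply: eq_bigr => P gP.
have exK := excess_leq gP.
rewrite hornerZ horner_prod_ffact; last lia.
have factE : (K./2 ^_ (K./2 - nfree P) * (nfree P)`!)%N = (K./2)`!.
  by rewrite -{2}(subKn (nfree_leq_half gP)) ffact_fact ?leq_subr.
by rewrite -natrM -factE -mulnA [((nfree P)`! * _)%N]mulnC bin_ffact subnDA.
Qed.

(** The term of [top_pair] is monic of degree [K./2]; all others have lower degree. *)
Lemma count_poly_lead K : count_poly K \is monic /\ size (count_poly K) = (K./2).+1.
Proof.
rewrite /count_poly (bigD1 (top_pair K)) ?good_top //= nfree_top subnn ffactn0 scale1r.
set q := \prod_(i <- _) _; set r := \sum_(P | _) _.
have sq : size q = (K./2).+1 by rewrite size_prod_XsubC size_iota.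
have sr : (size r < size q)%N.
  rewrite sq ltnS; apply: (leq_trans (size_sum _ _ _)); apply/bigmax_leqP => P /andP[gP neq].
  apply: (leq_trans (size_scale_leq _ _)); rewrite size_prod_XsubC size_iota.
  exact: nfree_lt_top.
by rewrite size_polyDl // monicE lead_coefDl // -monicE monic_prod_XsubC.
Qed.

Theorem theorem1p13 (k : int) (hk : -1 <= k) :
  let d : nat := `|((k + 1) %/ 2)%Z|%N in
  exists h : {poly rat},
    [/\ size h = d.+1,
        (forall g : nat, ((9 * k + 7)%:~R / 2%:R <= g%:R :> rat) ->
           exists s : seq {fset nat},
             [/\ uniq s,
                 (forall G : {fset nat}, G \in s <->
                    [/\ is_num_semigroup G, genus G = g &
                        exists e : nat, (e%:Z = g%:Z - k) /\ has_embedding_dim G e])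
               & (size s)%:R = h.[g%:R]])
      & exists p : {poly int}, p \is monic /\ map_poly intr p = d`!%:R *: h].
Proof.
move=> d; pose K := absz (k + 1).
have kK : k = K%:Z - 1 by rewrite /K; lia.
(* The floor of [(k + 1) / 2] is the ceiling of [k / 2]. *)
have -> : d = K./2 by rewrite /d /K; lia.
have [p_monic p_size] := count_poly_lead K.
have fact_neq0 : (K./2)`!%:R != 0 :> rat by rewrite pnatr_eq0 -lt0n fact_gt0.
exists ((K./2)`!%:R^-1 *: map_poly intr (count_poly K)); split.
- by rewrite size_scale ?invr_eq0 // size_map_inj_poly //; apply: intr_inj.
- move=> g; rewrite ler_pdivrMr ?ltr0n // -natrM => gk.
  have {}gk : 9 * k + 7 <= (g * 2)%N%:Z by rewrite -(ler_int rat).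
  (* With [k = K - 1] this is [9k + 7 <= 2g]; it also keeps [g + 1 - K] from being truncated. *)
  have gK : (9 * K <= 2 * g + 2)%N by lia.
  have [s [s_uniq s_mem s_size]] := @count_semigroups K g gK (g + 1 - K) ltac:(lia).
  exists s; split=> //.
    move=> G; rewrite s_mem; split=> -[G_sg G_g]; last first.
      case=> e [eE G_e]; split=> //.
      by have <- : e = (g + 1 - K)%N by lia.
    by move=> G_e; split=> //; exists (g + 1 - K)%N; split=> //; lia.
  have -> : g%:R = (g%:R : int)%:~R :> rat by rewrite rmorph_nat.
  by rewrite hornerZ horner_map horner_count_poly // rmorph_nat natrM mulKf // s_size.
- by exists (count_poly K); rewrite scalerA mulfV // scale1r.
Qed.
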